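(* Let $w := (w_n)_{n \in \mathbb{N}}$ be a bounded sequence of scalars in $\mathbb{K}$. The unilateral weighted backward shift $$B_w : (x_1,x_2,x_3,\ldots) \in c_0(\mathbb{N}) \mapsto (w_1x_2,w_2x_3,\ldots) \in c_0(\mathbb{N})$$ is Li-Yorke chaotic if and only if $$\sup\{|w_i \cdots w_j| : i,j \in \mathbb{N}, i \leq j\} = \infty.$$
   Context: $\mathbb{K}$ denotes $\mathbb{R}$ or $\mathbb{C}$, and $\mathbb{N} = \{1,2,3,\ldots\}$. $c_0(\mathbb{N})$ is the Banach space of $\mathbb{K}$-valued null sequences with the supremum norm. For $i \leq j$, $w_i\cdots w_j$ denotes the product of all $w_l$ with $i \leq l \leq j$. A continuous map $g : M \to M$ on a metric space $(M,d)$ is Li-Yorke chaotic if there is an uncountable set $S \subset M$ such that for all distinct $x,y \in S$, $\liminf_{n \to \infty} d(g^n(x),g^n(y)) = 0$ and $\limsup_{n\to\infty} d(g^n(x),g^n(y)) > 0$. *)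

(* Defs.v *)
From HB Require Import structures.
From mathcomp Require Import all_boot all_order all_algebra.
From mathcomp Require Import all_classical all_reals all_analysis.
From mathcomp Require Import complex.

Set Implicit Arguments.
Unset Strict Implicit.
Unset Printing Implicit Defensive.

Import Order.TTheory GRing.Theory Num.Theory.
Import numFieldNormedType.Exports.

Local Open Scope classical_set_scope.
Local Open Scope ring_scope.
Local Open Scope complex_scope.

(* A field with a real absolute value. The only purpose of this structure is to
   treat the scalar fields R and C at the same time: its instances are R^o
   (that is, R) and R[i]. The norm of R[i] as a numDomainType takes values in
   R[i], hence the use of the R-valued modulus normc. *)
HB.mixin Record Field_hasAbs (R : realType) K & GRing.Field K := {
  absv : K -> R;
  absv_ge0 : forall x, 0 <= absv x;
  absv_eq0 : forall x, (absv x == 0) = (x == 0);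
  absvD : forall x y, absv (x + y) <= absv x + absv y;
  absvM : forall x y, absv (x * y) = absv x * absv y
}.

#[short(type="absFieldType")]
HB.structure Definition AbsField (R : realType) :=
  { K of GRing.Field K & Field_hasAbs R K }.

HB.instance Definition _ (R : realType) :=
  Field_hasAbs.Build R R^o (@normr_ge0 R R) (@normr_eq0 R R)
    (@ler_normD R R) (@normrM R).

Fact normc_ge0 (R : realType) (z : R[i]) : 0 <= Normc.normc z.
Proof. by case: z => a b; exact: sqrtr_ge0. Qed.

Fact normc_eq0 (R : realType) (z : R[i]) : (Normc.normc z == 0) = (z == 0).
Proof.
apply/eqP/eqP => [|->]; first exact: Normc.eq0_normc.
exact: Normc.normc0.
Qed.

HB.instance Definition _ (R : realType) :=
  Field_hasAbs.Build R R[i] (@normc_ge0 R) (@normc_eq0 R)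
    (@le_normcD R) (@Normc.normcM R).

Lemma absv0 (R : realType) (K : absFieldType R) : absv (0 : K) = 0 :> R.
Proof. by apply/eqP; rewrite absv_eq0. Qed.

Lemma absv1 (R : realType) (K : absFieldType R) : absv (1 : K) = 1 :> R.
Proof.
have a1 : absv (1 : K) != 0 :> R by rewrite absv_eq0 oner_eq0.
by apply: (mulfI a1); rewrite -absvM !mulr1.
Qed.

Lemma absvN (R : realType) (K : absFieldType R) (x : K) :
  absv (- x) = absv x :> R.
Proof.
suff aN1 : absv (-1 : K) = 1 :> R by rewrite -mulN1r absvM aN1 mul1r.
apply/eqP; rewrite -(@eqrXn2 _ 2)// ?absv_ge0//.
by rewrite expr1n expr2 -absvM mulrNN mulr1 absv1.
Qed.

Section c0.
Variables (R : realType) (K : absFieldType R).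

Definition null_seq : {pred nat -> K} :=
  fun x => `[< absv (x n) @[n --> \oo] --> (0 : R) >].

Lemma null_seqP (x : nat -> K) :
  reflect (absv (x n) @[n --> \oo] --> (0 : R)) (x \in null_seq).
Proof. exact: asboolP. Qed.

Lemma null_seq_dominated (x : nat -> K) (y : nat -> R) :
  (forall n, absv (x n) <= y n) -> y n @[n --> \oo] --> (0 : R) -> x \in null_seq.
Proof.
move=> xy y0; apply/null_seqP.
apply: (@squeeze_cvgr _ _ _ _ (cst 0) y) => //; last exact: cvg_cst.
by apply: nearW => n; rewrite absv_ge0 xy.
Qed.

Fact null_seq_zmod_closed : zmod_closed null_seq.
Proof.
split=> [|x y /null_seqP x0 /null_seqP y0].
  apply: (@null_seq_dominated _ (cst 0)); last exact: cvg_cst.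
  by move=> n; rewrite absv0.
apply: (@null_seq_dominated _ (fun n => absv (x n) + absv (y n))).
  by move=> n; rewrite -(absvN (y n)); exact: absvD.
by rewrite -(addr0 (0 : R)); exact: cvgD.
Qed.

HB.instance Definition _ :=
  GRing.isZmodClosed.Build (nat -> K) null_seq null_seq_zmod_closed.

(* Sequences are indexed from 0: the entry c0_seq x n is x_(n+1);
   likewise w n stands for w_(n+1) in the weight sequences below. *)
Record c0 := C0 { c0_seq :> nat -> K; c0_seqP : c0_seq \in null_seq }.

HB.instance Definition _ := [isSub for c0_seq].
HB.instance Definition _ := [Choice of c0 by <:].
HB.instance Definition _ := [SubChoice_isSubZmodule of c0 by <:].

Lemma c0_null (x : c0) : absv (x n) @[n --> \oo] --> (0 : R).
Proof. exact/null_seqP/c0_seqP. Qed.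

Lemma c0_eqP (x y : c0) : x = y <-> forall n, x n = y n.
Proof. by split=> [-> //|xy]; apply/val_inj/funext. Qed.

Fact null_seqZ (a : K) (x : c0) : (fun n => a * x n) \in null_seq.
Proof.
apply: (@null_seq_dominated _ (fun n => absv a * absv (x n))).
  by move=> n; rewrite absvM.
by rewrite -(mulr0 (absv a : R)); apply: cvgMl_tmp; exact: c0_null.
Qed.

Definition c0_scale (a : K) (x : c0) : c0 := C0 (null_seqZ a x).

Fact c0_scaleA a b x : c0_scale a (c0_scale b x) = c0_scale (a * b) x.
Proof. by apply/c0_eqP => n /=; rewrite mulrA. Qed.

Fact c0_scale1 : left_id 1 c0_scale.
Proof. by move=> x; apply/c0_eqP => n /=; rewrite mul1r. Qed.

Fact c0_scaleDr : right_distributive c0_scale +%R.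
Proof. by move=> a x y; apply/c0_eqP => n /=; rewrite mulrDr. Qed.

Fact c0_scaleDl x : {morph c0_scale^~ x : a b / a + b}.
Proof. by move=> a b; apply/c0_eqP => n /=; rewrite mulrDl. Qed.

HB.instance Definition _ := GRing.Zmodule_isLmodule.Build K c0
  c0_scaleA c0_scale1 c0_scaleDr c0_scaleDl.

Definition c0_norm (x : c0) : R := sup (range (fun n => absv (x n))).

Lemma c0_has_sup (x : c0) : has_sup (range (fun n => absv (x n) : R)).
Proof.
split; first by exists (absv (x 0)), 0%N.
have /cvg_seq_bounded[M [_ Mx]] : cvgn (fun n => absv (x n) : R).
  by apply/cvg_ex; exists 0; exact: c0_null.
exists (M + 1) => _ [n _ <-]; apply: le_trans (Mx (M + 1) _ n I).
  exact: ler_norm.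
by rewrite ltrDl.
Qed.

Lemma c0_norm_ub (x : c0) n : absv (x n) <= c0_norm x.
Proof. by apply: ub_le_sup; [case: (c0_has_sup x)|exists n]. Qed.

Lemma c0_norm_le (x : c0) M : (forall n, absv (x n) <= M) -> c0_norm x <= M.
Proof.
by move=> xM; apply: ge_sup => [|_ [n _ <-]//]; case: (c0_has_sup x).
Qed.

Fact c0_normD x y : c0_norm (x + y) <= c0_norm x + c0_norm y.
Proof.
apply: c0_norm_le => n; apply: le_trans (absvD _ _) _.
by apply: lerD; exact: c0_norm_ub.
Qed.

Fact c0_norm_eq0 x : c0_norm x = 0 -> x = 0.
Proof.
move=> x0; apply/c0_eqP => n; apply/eqP.
by rewrite -absv_eq0 eq_le absv_ge0 andbT -x0 c0_norm_ub.
Qed.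

Fact c0_normZ (a : K) x : c0_norm (a *: x) = absv a * c0_norm x.
Proof.
apply/eqP; rewrite eq_le; apply/andP; split.
  by apply: c0_norm_le => n; rewrite absvM ler_wpM2l ?absv_ge0 ?c0_norm_ub.
have [->|a0] := eqVneq a 0.
  by rewrite absv0 mul0r (le_trans (absv_ge0 _) (c0_norm_ub _ 0)).
have a_gt0 : 0 < absv a :> R by rewrite lt_def absv_eq0 a0 absv_ge0.
rewrite mulrC -ler_pdivlMr//; apply: c0_norm_le => n.
by rewrite ler_pdivlMr// mulrC -absvM (c0_norm_ub (a *: x)).
Qed.

Fact c0_normN x : c0_norm (- x) = c0_norm x.
Proof. by rewrite -scaleN1r c0_normZ absvN absv1 mul1r. Qed.

Definition c0_dist (x y : c0) : R := c0_norm (x - y).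

Fact c0_distxx x : c0_dist x x = 0.
Proof.
by rewrite /c0_dist subrr -(scale0r (0 : c0)) c0_normZ absv0 mul0r.
Qed.

Fact c0_dist_positivity x y : c0_dist x y = 0 -> x = y.
Proof. by move/c0_norm_eq0/eqP; rewrite subr_eq0 => /eqP. Qed.

Fact c0_dist_sym x y : c0_dist x y = c0_dist y x.
Proof. by rewrite /c0_dist -opprB c0_normN. Qed.

Fact c0_dist_triangle y x z : c0_dist x z <= c0_dist x y + c0_dist y z.
Proof. by rewrite /c0_dist -(subrKA y); exact: c0_normD. Qed.

HB.instance Definition _ := isMetric.Build R c0
  c0_distxx c0_dist_positivity c0_dist_sym c0_dist_triangle.

Definition bounded_weights (w : nat -> K) :=
  exists M : R, forall n, absv (w n) <= M.

Fact null_seq_shift (w : nat -> K) (bw : bounded_weights w) (x : c0) :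
  (fun n => w n * x n.+1) \in null_seq.
Proof.
case: bw => M wM; apply: (@null_seq_dominated _ (fun n => M * absv (x n.+1))).
  by move=> n; rewrite absvM ler_wpM2r ?absv_ge0.
rewrite -(mulr0 M); apply: cvgMl_tmp.
by rewrite (@cvg_shiftS R^o (fun n => absv (x n) : R)); exact: c0_null.
Qed.

Definition backward_shift (w : nat -> K) (bw : bounded_weights w) (x : c0) : c0 :=
  C0 (null_seq_shift bw x).

End c0.

Definition li_yorke_chaotic (R : realType) (M : metricType R) (g : M -> M) :=
  continuous g /\
  exists2 S : set M, ~ countable S &
    forall x y, S x -> S y -> x <> y ->
      let d n := (mdist (iter n g x) (iter n g y))%:E in
      limn_einf d = 0%E /\ (0 < limn_esup d)%E.

(* Main.v *)
(* If all products of consecutive weights are bounded by C, then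
   ||B^n z|| <= C ||B^m z|| for n >= m, so a pair whose orbits come arbitrarily
   close is asymptotic and no scrambled set has two points. Conversely, if the
   products are unbounded, choose successively blocks i_k, n_k such that
   Q_k = |w_(i_k) ... w_(i_k + n_k - 1)| > (m_k + 1) M^(m_k + 1), where M >= 1
   bounds the weights and m_(k+1) = i_k + n_k. The sparse vector x with entry
   (w_(i_k) ... w_(i_k + n_k - 1))^-1 at position m_(k+1) satisfies
   ||B^(n_k) x|| >= 1. At time m_k + 1 only the entries at positions m_(j+1),
   j >= k, survive, whence ||B^(m_k + 1) x|| <= 1 / (m_k + 1). The line spanned
   by x is then a scrambled set, uncountable because the scalar field is. *)
Require Import Defs.
From mathcomp Require Import all_boot all_order all_algebra.
From mathcomp Require Import all_classical all_reals all_analysis.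
From mathcomp Require Import complex.
Import Order.TTheory GRing.Theory Num.Theory.
Import numFieldNormedType.Exports.

Local Open Scope classical_set_scope.
Local Open Scope ring_scope.
Local Open Scope complex_scope.

(** * Lower and upper limits from eventual or frequent inequalities *)

Section limn_esup_einf.
Context {R : realType}.
Implicit Types (u : nat -> \bar R) (l : \bar R).

Lemma limn_esup_le u l N :
  (forall n, (N <= n)%N -> (u n <= l)%E) -> (limn_esup u <= l)%E.
Proof.
move=> ul; rewrite /limn_esup /limf_esup.
apply: (@le_trans _ _ (ereal_sup [set u n | n in [set n | (N <= n)%N]])).
  apply: ereal_inf_lbound; exists [set n | (N <= n)%N] => //.
  by exists N.
by apply: ge_ereal_sup => _ [n /= Nn <-]; exact: ul.
Qed.

Lemma limn_esup_ge u l :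
  (forall N, exists2 n, (N <= n)%N & (l <= u n)%E) -> (l <= limn_esup u)%E.
Proof.
move=> lu; rewrite /limn_esup /limf_esup.
apply: le_ereal_inf_tmp => _ [V [N _ NV] <-].
have [n Nn ln] := lu N; apply: le_trans ln _.
by apply: ereal_sup_ubound; exists n => //; exact: NV.
Qed.

Lemma limn_einf_ge u l N :
  (forall n, (N <= n)%N -> (l <= u n)%E) -> (l <= limn_einf u)%E.
Proof.
move=> lu; rewrite /limn_einf leeNr; apply: (@limn_esup_le _ _ N) => n Nn /=.
by rewrite leeN2 lu.
Qed.

Lemma limn_einf_le u l :
  (forall N, exists2 n, (N <= n)%N & (u n <= l)%E) -> (limn_einf u <= l)%E.
Proof.
move=> ul; rewrite /limn_einf leeNl; apply: limn_esup_ge => N.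
by have [n Nn un] := ul N; exists n => //; rewrite leeN2.
Qed.

End limn_esup_einf.

(** * Uncountability of the two scalar fields *)

Lemma uncountable_real (R : realType) : ~ countable [set: R].
Proof.
move=> /countable_lebesgue_measure0.
by rewrite -set_itvNyy lebesgue_measure_itv/=.
Qed.

Lemma uncountable_complex (R : realType) : ~ countable [set: R[i]].
Proof.
move=> Ccount; apply: (@uncountable_real R).
rewrite -(eq_countable (@inj_card_eq _ _ _ (fun r : R => r%:C) _)).
  exact: sub_countable (subset_card_le (@subsetT _ _)) Ccount.
by move=> r s _ _ [].
Qed.

(** * Orbits of the weighted shift and the equivalence *)

Section backward_shift.
Context {R : realType} {K : absFieldType R} {w : nat -> K}.
Variable bw : bounded_weights w.
Implicit Types (x y : c0 K).

Local Notation B := (backward_shift bw).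
Local Notation P i n := (\prod_(i%N <= l < i + n) w l).

(** Each application moves entries one place and contributes one weight; all norm estimates on
    orbits rest on this closed form. *)
Lemma iter_backward_shift n x i : iter n B x i = P i n * x (i + n)%N.
Proof.
elim: n i => [|n IHn] i; first by rewrite addn0 big_geq// mul1r.
rewrite iterS /= IHn mulrA -addSnnS [in RHS]big_ltn//.
by rewrite addSn ltnS leq_addr.
Qed.

Lemma iter_backward_shiftZB n (a b : K) x :
  iter n B (a *: x) - iter n B (b *: x) = (a - b) *: iter n B x.
Proof.
apply/c0_eqP => i; change (iter n B (a *: x) i - iter n B (b *: x) i =
  (a - b) * iter n B x i).
rewrite !iter_backward_shift.
change (P i n * (a * x (i + n)%N) - P i n * (b * x (i + n)%N) =
  (a - b) * (P i n * x (i + n)%N)).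
by rewrite -mulrBr -mulrBl mulrCA.
Qed.

Lemma iter_backward_shiftB n x y :
  iter n B x - iter n B y = iter n B (x - y).
Proof.
apply/c0_eqP => i; rewrite iter_backward_shift.
change (iter n B x i - iter n B y i = P i n * (x (i + n)%N - y (i + n)%N)).
by rewrite !iter_backward_shift mulrBr.
Qed.

Lemma continuous_backward_shift : continuous B.
Proof.
have [M wM] := bw => x.
have M0 : 0 <= M by exact: le_trans (absv_ge0 _) (wM 0%N).
apply/(@metricType_numDomainType.cvgrPdist_lt _ _ _ _ (nbhs_filter x)) => e e0.
have M1 : 0 < M + 1 by rewrite ltr_wpDl.
have : \forall y \near x, mdist x y < e / (M + 1).
  apply/metricType_numDomainType.nbhs_mdistP.
  by exists (e / (M + 1)) => //=; rewrite divr_gt0.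
apply: filterS => y; rewrite ltr_pdivlMr// => xy; apply: le_lt_trans xy.
(* Seeing [B] as its first iterate makes linearity of the iterates applicable. *)
rewrite -[mdist _ _]/(c0_norm (iter 1 B x - iter 1 B y)) iter_backward_shiftB.
apply: c0_norm_le => n; rewrite absvM mulrC ler_pM ?absv_ge0//.
  exact: (c0_norm_ub (x - y)).
by rewrite (le_trans (wM n))// lerDl.
Qed.

Lemma absv_weight_prod_le {M : R} i n :
  (forall l, absv (w l) <= M) -> absv (P i n) <= M ^+ n.
Proof.
move=> wM; elim: n => [|n IHn]; first by rewrite addn0 big_geq// absv1.
rewrite addnS big_nat_recr ?leq_addr//= absvM exprSr.
by rewrite ler_pM ?absv_ge0.
Qed.

Lemma li_yorke_chaotic_unbounded_prod :
  li_yorke_chaotic B -> forall C : R, exists i n, C < absv (P i n).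
Proof.
move=> [_ [S Suncount Schaos]] C; apply: contrapT => noC.
have PC i n : absv (P i n) <= C.
  by rewrite leNgt; apply/negP => CP; apply: noC; exists i, n.
have C0 : 0 < C.
  by apply: lt_le_trans (PC 0%N 0%N); rewrite big_geq// absv1.
have iterC n x : c0_norm (iter n B x) <= C * c0_norm x.
  apply: c0_norm_le => i; rewrite iter_backward_shift absvM.
  by rewrite ler_pM ?absv_ge0 ?c0_norm_ub.
apply: Suncount.
have [[x Sx]|/forallNP S0] := pselect (exists x, S x); last first.
  suff -> : S = set0 by exact: countable0.
  by rewrite -subset0 => x Sx; exact: (S0 x).
apply: (@sub_countable _ _ _ [set x]); last exact: countable1.
apply: subset_card_le => y Sy /=; apply: contrapT => /nesym xy.
have [infd] := Schaos _ _ Sx Sy xy.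
apply/negP; rewrite -leNgt.
apply/lee_addgt0Pr => e e0; rewrite add0e.
(* One time with distance below [e / C] suffices: from then on the distance grows by a factor of at
   most [C]. *)
have [m dm] : exists m, mdist (iter m B x) (iter m B y) < e / C.
  apply: contrapT => /forallNP dm.
  have : ((e / C)%:E <= 0 :> \bar R)%E.
    rewrite -infd; apply: (@limn_einf_ge _ _ _ 0%N) => n _.
    by rewrite lee_fin leNgt; exact/negP/dm.
  by rewrite lee_fin leNgt divr_gt0.
apply: (@limn_esup_le _ _ _ m) => n mn; rewrite lee_fin.
rewrite -[mdist _ _]/(c0_norm (iter n B x - iter n B y)).
rewrite -(subnK mn) !iterD iter_backward_shiftB.
apply: le_trans (iterC _ _) _.
by rewrite mulrC -ler_pdivlMr// ltW.
Qed.

(** Such an orbit returns arbitrarily close to 0 yet does not tend to 0; by linearity, any two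
    distinct multiples of [x] inherit this behaviour. *)
Lemma semi_irregular_vector :
  (forall C : R, exists i n, C < absv (P i n)) ->
  exists x : c0 K,
    (forall e, 0 < e -> forall N,
      exists2 n, (N <= n)%N & c0_norm (iter n B x) <= e) /\
    (forall N, exists2 n, (N <= n)%N & 1 <= c0_norm (iter n B x)).
Proof.
move=> unbP; have [M0 wM0] := bw.
(* A bound of at least 1 makes the powers of [M] nondecreasing in the exponent. *)
pose M := Num.max M0 1.
have wM l : absv (w l) <= M by rewrite le_max wM0.
have M1 : 1 <= M by rewrite le_max lexx orbT.
have MX_gt0 p : 0 < M ^+ p by rewrite exprn_gt0// (lt_le_trans ltr01).
have [f fP] : {f : nat -> nat * nat & forall p,
    p.+1%:R * M ^+ p.+1 < absv (P (f p).1 (f p).2)}.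
  apply: (@choice _ _
    (fun p q => p.+1%:R * M ^+ p.+1 < absv (P q.1 q.2))) => p.
  by have [i [n Pin]] := unbP (p.+1%:R * M ^+ p.+1); exists (i, n).
(* Each block is chosen with the end of the previous one as threshold, so its gain beats any product
   of [(m k).+1] weights. *)
pose m k := iter k (fun p => ((f p).1 + (f p).2)%N) 0%N.
pose a k := (P (f (m k)).1 (f (m k)).2)^-1.
have mS k : m k.+1 = ((f (m k)).1 + (f (m k)).2)%N by [].
(* A product of at most [p] weights is at most [M ^+ p]. *)
have f2_gt p : (p < (f p).2)%N.
  rewrite ltnNge; apply/negP => fp.
  have := lt_le_trans (fP p) (absv_weight_prod_le (f p).1 (f p).2 wM).
  apply/negP; rewrite -leNgt.
  rewrite (@le_trans _ _ (M ^+ p.+1))// ?ler_weXn2l ?(leqW fp)//.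
  by rewrite ler_peMl ?(ltW (MX_gt0 _))// ler1n.
have m_incr k : (m k < m k.+1)%N by rewrite mS ltn_addl.
have m_mono : {mono m : k l / (k <= l)%N}.
  by apply: leq_mono; apply: homo_ltn => //; exact: ltn_trans.
have m_ge k : (k <= m k)%N.
  by elim: k => // k IHk; exact: leq_ltn_trans (m_incr k).
have P_gt0 k : 0 < absv (P (f (m k)).1 (f (m k)).2).
  by apply: le_lt_trans (fP _); rewrite mulr_ge0 ?ler0n ?ltW.
have aE k : absv (a k) * absv (P (f (m k)).1 (f (m k)).2) = 1.
  by rewrite -absvM mulVf ?absv1// -(@absv_eq0 R) gt_eqF.
have a_le k : M ^+ (m k).+1 * absv (a k) <= (m k).+1%:R^-1.
  rewrite -(ler_pM2r (P_gt0 k)) -mulrA aE mulr1 mulrC ler_pdivlMr//.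
  by rewrite mulrC ltW.
have [x xP] : {x : nat -> K & forall q,
    (exists2 k, q = m k.+1 & x q = a k) \/
    (x q = 0 /\ forall k, q <> m k.+1)}.
  apply: (@choice _ _ (fun q v => (exists2 k, q = m k.+1 & v = a k) \/
    (v = 0 /\ forall k, q <> m k.+1))) => q.
  have [[k qk]|/forallNP qk] := pselect (exists k, q = m k.+1).
    by exists (a k); left; exists k.
  by exists 0; right.
have xm k : x (m k.+1) = a k.
  case: (xP (m k.+1)) => [[l mkl ->]|[_ /(_ k)]//].
  by congr a; apply/eqP; rewrite -eqSS -(inj_eq (incn_inj m_mono)) mkl.
(* A nonzero entry beyond [m p] sits at some [m k.+1] with [p <= k], where [a_le] gives a bound that
   only improves with [k]. *)
have x_small p q : (m p < q)%N -> M ^+ (m p).+1 * absv (x q) <= p.+1%:R^-1.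
  move=> pq; case: (xP q) => [[k qk ->]|[-> _]]; last first.
    by rewrite absv0 mulr0 invr_ge0.
  have pk : (p <= k)%N by rewrite -ltnS ltnNge -m_mono -qk -ltnNge.
  apply: (@le_trans _ _ (M ^+ (m k).+1 * absv (a k))).
    by rewrite ler_wpM2r ?absv_ge0// ler_weXn2l// ltnS m_mono.
  apply: le_trans (a_le k) _.
  by rewrite lef_pV2 ?posrE// ler_nat ltnS (leq_trans pk).
have inv_small e : 0 < e -> exists p, p.+1%:R^-1 <= e :> R.
  move=> e0; exists (Num.truncn e^-1); rewrite invf_ple ?posrE//.
  by rewrite ltW// truncnS_gt.
have x0 : x \in @null_seq R K.
  apply/null_seqP/cvgrPdist_le => e /inv_small[p pe].
  near=> q; rewrite sub0r normrN ger0_norm ?absv_ge0//.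
  apply: le_trans pe; apply: le_trans (x_small p q _).
    by rewrite ler_peMl ?absv_ge0// exprn_ege1.
  by near: q; exact: nbhs_infty_gt.
exists (C0 x0); split=> [e /inv_small[p pe] N|N].
  (* The maximum serves both demands: a time past [N] and a norm below [p.+1%:R^-1]. *)
  exists (m (maxn p N)).+1.
    by rewrite leqW// (leq_trans (leq_maxr p N)).
  apply: c0_norm_le => i; rewrite iter_backward_shift absvM/=.
  apply: (@le_trans _ _
    (M ^+ (m (maxn p N)).+1 * absv (x (i + (m (maxn p N)).+1)%N))).
    by rewrite ler_wpM2r ?absv_ge0// absv_weight_prod_le.
  apply: le_trans pe; apply: le_trans (x_small _ _ _) _.
    by rewrite addnS ltnS leq_addl.
  by rewrite lef_pV2 ?posrE// ler_nat ltnS leq_maxl.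
(* After exactly the block length, the entry at [m N.+1] reaches the start of the block, multiplied
   by the product it inverts. *)
exists (f (m N)).2; first exact: leq_trans (ltnW (f2_gt _)).
apply: le_trans (c0_norm_ub _ (f (m N)).1).
by rewrite iter_backward_shift absvM/= -mS xm mulrC aE.
Unshelve. all: by end_near. Qed.

Theorem li_yorke_chaotic_backward_shift : ~ countable [set: K] ->
  li_yorke_chaotic B <->
  ereal_sup [set r : \bar R | exists i j : nat, (i <= j)%N /\
               r = (absv (\prod_(i <= l < j.+1) w l))%:E] = +oo%E.
Proof.
move=> Kuncount; split=> [Bchaos|supP].
  apply: eq_infty => C.
  (* The maximum with 1 excludes the empty product, since the supremum ranges over nonempty blocks
     only. *)
  have [i [n CP]] := li_yorke_chaotic_unbounded_prod Bchaos (Num.max C 1).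
  case: n CP => [|n]; first by rewrite addn0 big_geq// absv1 gt_max ltxx andbF.
  rewrite addnS gt_max => /andP[CP _].
  apply: (@le_trans _ _ (absv (\prod_(i <= l < (i + n).+1) w l))%:E).
    by rewrite lee_fin ltW.
  by apply: ereal_sup_ubound; exists i, (i + n)%N; rewrite leq_addr.
have unbP (C : R) : exists i n, C < absv (P i n).
  have : (C%:E < +oo)%E by exact: ltry.
  rewrite -supP => /ereal_sup_gt[_ [i [j [ij ->]]]]; rewrite lte_fin => CP.
  by exists i, (j.+1 - i)%N; rewrite subnKC// leqW.
split; first exact: continuous_backward_shift.
have [x [xsmall xlarge]] := semi_irregular_vector unbP.
have distE a b n :
    mdist (iter n B (a *: x)) (iter n B (b *: x)) =
    absv (a - b) * c0_norm (iter n B x) :> R.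
  by rewrite -c0_normZ -iter_backward_shiftZB.
exists (range (fun a => a *: x)).
  (* Scaling [x] is injective: if two multiples coincide, either the scalars agree or the whole
     orbit of [x] has norm 0, contradicting [xlarge]. *)
  rewrite (eq_countable (inj_card_eq _)) // => a b _ _ abx.
  have [n _] := xlarge 0%N.
  have := distE a b n; rewrite /= abx metric_structure.mdistxx => /esym/eqP.
  rewrite mulf_eq0 absv_eq0 subr_eq0 => /orP[/eqP//|/eqP ->].
  by rewrite ler10.
move=> _ _ [a _ <-] [b _ <-] abx d.
have ab0 : 0 < absv (a - b) :> R.
  rewrite lt_def absv_ge0 absv_eq0 subr_eq0 andbT.
  by apply/eqP => ab; rewrite ab in abx.
split.
  apply/eqP; rewrite eq_le; apply/andP; split.
    apply/lee_addgt0Pr => e e0; rewrite add0e.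
    apply: limn_einf_le => N.
    have [n Nn xn] := xsmall (e / absv (a - b)) (divr_gt0 e0 ab0) N.
    by exists n => //; rewrite lee_fin distE mulrC -ler_pdivlMr.
  by apply: (@limn_einf_ge _ _ _ 0%N) => n _; rewrite lee_fin mdist_ge0.
apply: (@lt_le_trans _ _ (absv (a - b))%:E); first by rewrite lte_fin.
apply: limn_esup_ge => N; have [n Nn xn] := xlarge N.
by exists n => //; rewrite lee_fin distE ler_peMr// ltW.
Qed.

End backward_shift.

Theorem corollary4 (R : realType) :
  (forall (w : nat -> R^o) (bw : bounded_weights w),
     li_yorke_chaotic (backward_shift bw) <->
     ereal_sup [set r : \bar R | exists i j : nat, (i <= j)%N /\
                 r = (absv (\prod_(i <= l < j.+1) w l))%:E] = +oo%E) /\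
  (forall (w : nat -> R[i]) (bw : bounded_weights w),
     li_yorke_chaotic (backward_shift bw) <->
     ereal_sup [set r : \bar R | exists i j : nat, (i <= j)%N /\
                 r = (absv (\prod_(i <= l < j.+1) w l))%:E] = +oo%E).
Proof.
split=> w bw; apply: li_yorke_chaotic_backward_shift.
  exact: uncountable_real.
exact: uncountable_complex.
Qed.
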